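(* Let $\mathcal{L}_T^{(k)}$ be the Laplacian matrix of a $k$-vertex connected threshold graph, with vertices ordered as described in the context, let $\boldsymbol{d}=(d_1,\dots,d_k)$ be its degree sequence and $\boldsymbol{d}^*=(d_1^*,\dots,d_k^* )$ the conjugate of $\boldsymbol{d}$. Let $\mathcal{V}$ be the matrix produced from $\mathcal{L}_T^{(k)}$ by Algorithm 1 (described in the context). Then, for each $j\in\{1,\dots,k\}$, the $j$th column of $\mathcal{V}$ is an eigenvector of $\mathcal{L}_T^{(k)}$ corresponding to the eigenvalue $d_j^*$, which is the $j$th largest eigenvalue of $\mathcal{L}_T^{(k)}$ (eigenvalues counted with multiplicity).
   Context: All graphs are simple (undirected, unweighted, no loops, no multiple edges) and connected. The Laplacian matrix of a graph is $\mathcal{L}=\mathcal{D}-\mathcal{A}$, with $\mathcal{D}$ the diagonal degree matrix and $\mathcal{A}$ the adjacency matrix. A threshold graph is a graph obtained from a single isolated vertex by adding vertices one at a time, each new vertex being either isolated (union) or adjacent to all existing vertices (join); it is connected (for $k\ge 2$) exactly when the last operation is a join. Vertex ordering: vertices are placed on a line during the construction, a vertex added by join being placed leftmost and a vertex added by union being placed rightmost; vertices are then numbered $1,\dots,k$ from left to right. With this numbering the degrees satisfy $d_1\ge d_2\ge\cdots\ge d_k$, and the neighbours of vertex $i$ are the first $d_i$ vertices of the list $1,2,\dots,k$ with $i$ itself omitted. $\mathcal{L}_T^{(k)}$ is the Laplacian matrix written in this ordering. The degree sequence is $\boldsymbol{d}=(d_1,\dots,d_k)$, $d_1\ge\cdots\ge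 d_k$, and its conjugate is $\boldsymbol{d}^*=(d_1^*,\dots,d_k^* )$ with $d_i^*=|\{j : d_j\ge i\}|$. Algorithm 1 (input $\mathcal{L}_T^{(k)}$, output $\mathcal{V}$): start with $\mathcal{V}=(v_{ij})=\mathcal{L}_T^{(k)}$. For $j=2,\dots,k$: for each $i=1,\dots,j-1$ replace $v_{ij}$ by $-1-v_{ij}$; then set $v_{jj}=-\sum_{i=1,\,i\ne j}^{k}v_{ij}$. After this, remove the zero column of $\mathcal{V}$ and append the all-ones column vector $\mathbf{1}$ as the last column. *)

(* Defs.v *)
From HB Require Import structures.
From mathcomp Require Import all_boot all_order all_algebra.

Set Implicit Arguments.
Unset Strict Implicit.
Unset Printing Implicit Defensive.

Import Order.TTheory GRing.Theory Num.Theory.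
Local Open Scope ring_scope.

(* Simple graphs are symmetric irreflexive relations on a finite type. *)
Definition simple_graph (T : finType) (e : rel T) : Prop :=
  symmetric e /\ irreflexive e.

Definition connected_graph (T : finType) (e : rel T) : Prop :=
  forall x y : T, connect e x y.

(* [threshold_line e s]: the subgraph of [e] induced by the vertices in [s]
   can be built from a single vertex by joins and unions, in such a way that
   [s] lists the vertices from left to right, each joined vertex having been
   placed leftmost and each vertex added by union rightmost. *)
Inductive threshold_line (T : finType) (e : rel T) : seq T -> Prop :=
| ThresholdStart (x : T) : threshold_line e [:: x]
| ThresholdJoin (x : T) (s : seq T) :
    threshold_line e s -> x \notin s ->
    (forall y : T, y \in s -> e x y) -> threshold_line e (x :: s)
| ThresholdUnion (x : T) (s : seq T) :
    threshold_line e s -> x \notin s ->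
    (forall y : T, y \in s -> ~~ e x y) -> threshold_line e (rcons s x).

(* [e] is a threshold graph exactly when it has such an ordering [s] of its
   whole vertex set. *)
Definition threshold_order (T : finType) (e : rel T) (s : seq T) : Prop :=
  threshold_line e s /\ forall x : T, x \in s.

Definition degree (T : finType) (e : rel T) (x : T) : nat :=
  #|[set y | e x y]|.

Definition degree_seq (T : finType) (e : rel T) (k : nat) (s : k.-tuple T) :
    k.-tuple nat :=
  [tuple degree e (tnth s i) | i < k].

(* Indices start at 0: the entry of index [i] is d*_(i+1), the number of
   entries of [d] that are at least i+1. *)
Definition conjugate_seq (k : nat) (d : k.-tuple nat) : k.-tuple nat :=
  [tuple #|[set j : 'I_k | (i.+1 <= tnth d j)%N]| | i < k].

Definition adjacency_mx (R : nzRingType) (T : finType) (e : rel T) (k : nat)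
    (s : k.-tuple T) : 'M[R]_k :=
  \matrix_(i, j) (e (tnth s i) (tnth s j))%:R.

Definition degree_mx (R : nzRingType) (T : finType) (e : rel T) (k : nat)
    (s : k.-tuple T) : 'M[R]_k :=
  diag_mx (\row_i (tnth (degree_seq e s) i)%:R).

Definition laplacian_mx (R : nzRingType) (T : finType) (e : rel T) (k : nat)
    (s : k.-tuple T) : 'M[R]_k :=
  degree_mx R e s - adjacency_mx R e s.

Definition flip_above (R : nzRingType) (k : nat) (j : 'I_k) (V : 'M[R]_k) :
    'M[R]_k :=
  \matrix_(i, l) if (l == j) && (i < j)%N then - 1 - V i l else V i l.

Definition reset_diag (R : nzRingType) (k : nat) (j : 'I_k) (V : 'M[R]_k) :
    'M[R]_k :=
  \matrix_(i, l)
    if (l == j) && (i == j) then - \sum_(m < k | m != j) V m j else V i l.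

(* The loop over the columns 2, ..., k, i.e. all but the one of index 0. *)
Definition column_loop (R : nzRingType) (n : nat) (L : 'M[R]_n.+1) :
    'M[R]_n.+1 :=
  foldl (fun V j => reset_diag j (flip_above j V)) L
        [seq j <- enum 'I_n.+1 | j != ord0].

(* The output is [None] unless, after the loop, there is exactly one zero
   column. *)
Definition algorithm1 (R : nzRingType) (n : nat) (L : 'M[R]_n.+1) :
    option 'M[R]_n.+1 :=
  let W := column_loop L in
  omap (fun j0 => castmx (erefl n.+1, addn1 n)
                    (row_mx (col' j0 W) (const_mx 1 : 'cV[R]_n.+1)))
       (unset1 [set j | col j W == 0]).

(* The eigenvectors of mxalgebra are row vectors; these are column vectors. *)
Definition eigenvector (R : nzRingType) (k : nat) (A : 'M[R]_k) (a : R)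
    (v : 'cV[R]_k) : Prop :=
  v != 0 /\ A *m v = a *: v.

(* [a] is the entry of index [j] in the nonincreasing list of all the
   eigenvalues of [A], repeated according to their multiplicity as roots of
   the characteristic polynomial (so [j = 0] is the largest eigenvalue). *)
Definition nth_largest_eigenvalue (R : realFieldType) (k : nat) (A : 'M[R]_k)
    (j : 'I_k) (a : R) : Prop :=
  exists s : k.-tuple R,
    [/\ sorted >=%R s, char_poly A = \prod_(x <- s) ('X - x%:P)
      & tnth s j = a].

(* Main.v *)
Require Import Defs.
From HB Require Import structures.
From mathcomp Require Import all_boot all_order all_algebra.
From mathcomp Require Import ring.

Set Implicit Arguments.
Unset Strict Implicit.
Unset Printing Implicit Defensive.

Import Order.TTheory GRing.Theory Num.Theory.
Local Open Scope ring_scope.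

(** The Laplacian of a threshold graph has a basis of eigenvectors made of the
    all-ones vector and of star vectors [#|S| e_j - 1_S], the sums over
    [i \in S] of the differences [e_j - e_i].

    Suppose that every vertex outside [S + j] is adjacent to all or to none of
    [S + j].  The Laplacian then maps a vector of sum zero supported on [S + j]
    to a vector supported on [S + j], and acts on it as the Laplacian of the
    induced subgraph plus the number of outside neighbours of [j].  If [j] is
    moreover adjacent to all of [S], or to none of it, the star vector is an
    eigenvector, with eigenvalue [deg j + 1], resp. [deg j] ([star_vec_eigen]).

    In a threshold graph let [c] be the vertex from which the construction
    starts: the vertices to its left are the joined ones and form a clique with
    [c], those to its right form an independent set with [c].  The loop of the
    algorithm turns column [j] into the star vector of [star_set a j], the set
    of the neighbours of [j] on its right and of its non-neighbours on its left
    ([column_loop_laplacian]).  Only the former occur when [j] is left of [c]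
    and only the latter when [j] is right of [c], and since neighbourhoods are
    nested, the eigenvector criterion applies ([threshold_star_eigen]).  For
    [j = c] the set is empty, and for [j <> c] it contains [c], so that exactly
    one column, that of [c], vanishes and is removed.  Counting degrees
    identifies the eigenvalues with the conjugate sequence ([conj_deg_left],
    [conj_deg_right]).

    What remains is to see that these eigenvectors form a basis, so that the
    conjugate sequence exhausts the spectrum with multiplicities.  A vector [y]
    orthogonal to the star vectors has at each [j <> c] the average of its
    values on [star_set a j], which contains [c]; by the maximum principle [y]
    is constant ([star_average_const]), and it vanishes if it is also
    orthogonal to the all-ones vector. *)

(** * Star vectors as Laplacian eigenvectors *)

Definition star_vec (R : nzRingType) (k : nat) (j : 'I_k) (S : {set 'I_k}) :
    'cV[R]_k :=
  \col_i ((i == j)%:R * #|S|%:R - (i \in S)%:R).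

Lemma dot_star_vec (R : nzRingType) (k : nat) (j : 'I_k) (S : {set 'I_k})
    (x : 'I_k -> R) :
  \sum_i x i * star_vec R j S i 0 = \sum_(i in S) (x j - x i).
Proof.
under eq_bigr => i _ do rewrite mxE mulrBr.
rewrite !sumrB; congr (_ - _).
  rewrite (bigD1 j) //= eqxx mul1r big1 => [|i /negbTE->]; last first.
    by rewrite mul0r mulr0.
  by rewrite addr0 sumr_const mulr_natr.
rewrite [RHS]big_mkcond; apply: eq_bigr => i _.
by case: (i \in S); rewrite ?mulr1 ?mulr0.
Qed.

Lemma degreeE (R : nzRingType) (T : finType) (a : rel T) (i : T) :
  (degree a i)%:R = \sum_l (a i l)%:R :> R.
Proof.
rewrite /degree -sum1dep_card natr_sum big_mkcond.
by apply: eq_bigr => l _; case: (a i l).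
Qed.

Lemma laplacianE (R : nzRingType) (k : nat) (a : rel 'I_k) (i j : 'I_k) :
  laplacian_mx R a (ord_tuple k) i j =
    (i == j)%:R * (degree a i)%:R - (a i j)%:R.
Proof.
by rewrite !mxE !tnth_ord_tuple tnth_mktuple tnth_ord_tuple mulr_natl.
Qed.

Lemma laplacian_mulE (R : comNzRingType) (k : nat) (a : rel 'I_k)
    (v : 'cV[R]_k) (i : 'I_k) :
  (laplacian_mx R a (ord_tuple k) *m v) i 0 =
    (degree a i)%:R * v i 0 - \sum_l (a i l)%:R * v l 0.
Proof.
rewrite mxE; under eq_bigr => l _ do rewrite laplacianE mulrBl.
rewrite sumrB (bigD1 i) //= eqxx mul1r big1 ?addr0 // => l.
by rewrite eq_sym => /negbTE->; rewrite !mul0r.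
Qed.

(** Off [S + j] both sides vanish because the differences [a i l - a i j] do.
    For [i] in [S], degrees are split into the parts inside [S], at [j], and
    outside; the outside parts of [i] and [j] agree. *)
Lemma star_vec_eigen (R : comNzRingType) (k : nat) (a : rel 'I_k) (j : 'I_k)
    (S : {set 'I_k}) (eps : bool) :
  symmetric a -> irreflexive a -> j \notin S ->
  {in S, forall l, a j l = eps} ->
  (forall i, i \notin S -> i != j -> {in S, forall l, a i l = a i j}) ->
  laplacian_mx R a (ord_tuple k) *m star_vec R j S =
    (degree a j + eps)%:R *: star_vec R j S.
Proof.
move=> syma irra jS epsS modS; apply/matrixP=> i o; rewrite (ord1 o) {o}.
rewrite laplacian_mulE dot_star_vec [RHS]mxE !mxE.
have [->|ij] := eqVneq i j.
  rewrite (negbTE jS) irra mul1r !subr0 natrD mulrDl; congr (_ + _).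
  under eq_bigr => l lS do rewrite (epsS l lS) sub0r.
  by rewrite sumrN opprK sumr_const mulr_natr.
rewrite !mul0r !sub0r; have [iS|iS] := boolP (i \in S); last first.
  rewrite !oppr0 !mulr0 sub0r big1 ?oppr0 // => l lS.
  by rewrite (modS i iS ij l lS) subrr.
have aij : a i j = eps by rewrite syma epsS.
rewrite !mulrN1 natrD aij sumrB -opprD; congr (- _).
have split_deg x : (degree a x)%:R =
    (a x j)%:R + (\sum_(l in S) (a x l)%:R
      + \sum_(l | (l \notin S) && (l != j)) (a x l)%:R) :> R.
  rewrite degreeE (bigD1 j) //=; congr (_ + _).
  rewrite (bigID (mem S)) /=; congr (_ + _); apply: eq_bigl => l.
    have [->|//] := eqVneq l j; first by rewrite (negbTE jS).
  by rewrite andbC.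
rewrite !split_deg irra aij add0r.
rewrite [\sum_(l in S) (a j l)%:R](eq_bigr (fun=> eps%:R)); last first.
  by move=> l lS; rewrite epsS.
have -> : \sum_(l | (l \notin S) && (l != j)) (a i l)%:R =
    \sum_(l | (l \notin S) && (l != j)) (a j l)%:R :> R.
  apply: eq_bigr => l /andP[lS lj].
  by rewrite syma (modS l lS lj i iS) syma.
ring.
Qed.

(** * The order structure of a threshold graph *)

(** Positions on the line are ordinals; [thr_dom] says that neighbourhoods are
    nested from right to left, and [c] is the position of the vertex from which
    the construction starts. *)
Record threshold_rel (k : nat) (a : rel 'I_k) (c : 'I_k) : Prop := {
  thr_sym : symmetric a;
  thr_irr : irreflexive a;
  thr_dom : forall i j l : 'I_k,
    (i < j)%N -> l != i -> l != j -> a j l -> a i l;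
  thr_left : forall i : 'I_k, (i < c)%N -> a i c;
  thr_right : forall i : 'I_k, (c < i)%N -> ~~ a i c }.

(** The support, [j] excepted, of column [j] after the column loop: an edge to
    the right gives an entry [-1], and flipping makes a non-edge to the left do
    so. *)
Definition star_set (k : nat) (a : rel 'I_k) (j : 'I_k) : {set 'I_k} :=
  [set i : 'I_k | if (i < j)%N then ~~ a j i else (j < i)%N && a j i].

Lemma ltn_neq (k : nat) (i j : 'I_k) : (i < j)%N -> i != j.
Proof. by rewrite ltn_neqAle => /andP[]. Qed.

(** The same nesting with the side conditions reduced to [i != l]: the case [l
    = j] is excluded by irreflexivity and [i = j] is trivial. *)
Lemma threshold_dom (k : nat) (a : rel 'I_k) (c i j l : 'I_k) :
  threshold_rel a c -> (i <= j)%N -> i != l -> a j l -> a i l.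
Proof.
move=> h; rewrite leq_eqVlt => /orP[/eqP/val_inj->//|ij] il ajl.
apply: (thr_dom h ij _ _ ajl); first by rewrite eq_sym.
by apply: contraTneq ajl => ->; rewrite (thr_irr h).
Qed.

Lemma threshold_clique (k : nat) (a : rel 'I_k) (c i j : 'I_k) :
  threshold_rel a c -> (i < j)%N -> (j <= c)%N -> a i j.
Proof.
move=> h ij jc; rewrite (thr_sym h).
apply: (threshold_dom h jc); first by rewrite eq_sym ltn_neq.
by rewrite (thr_sym h) (thr_left h) // (leq_trans ij).
Qed.

Lemma threshold_indep (k : nat) (a : rel 'I_k) (c i j : 'I_k) :
  threshold_rel a c -> (c <= i)%N -> (i < j)%N -> ~~ a i j.
Proof.
move=> h ci ij; have cj := leq_ltn_trans ci ij.
apply: contra (thr_right h cj) => aij; rewrite (thr_sym h).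
exact: threshold_dom h ci (ltn_neq cj) aij.
Qed.

Lemma star_set_notin (k : nat) (a : rel 'I_k) (j : 'I_k) :
  j \notin star_set a j.
Proof. by rewrite inE ltnn. Qed.

Lemma star_set_left (k : nat) (a : rel 'I_k) (c j : 'I_k) :
  threshold_rel a c -> (j < c)%N ->
  star_set a j = [set i : 'I_k | (j < i)%N && a j i].
Proof.
move=> h jc; apply/setP=> i; rewrite !inE; case: ifP => // ij.
by rewrite ltnNge ltnW //= (thr_sym h) (threshold_clique h) // ltnW.
Qed.

Lemma star_set_right (k : nat) (a : rel 'I_k) (c j : 'I_k) :
  threshold_rel a c -> (c <= j)%N ->
  star_set a j = [set i : 'I_k | (i < j)%N && ~~ a j i].
Proof.
move=> h cj; apply/setP=> i; rewrite !inE; case: ifP => // ij.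
apply/negP => /andP[ji]; exact/negP/(threshold_indep h).
Qed.

Lemma star_set_centre (k : nat) (a : rel 'I_k) (c : 'I_k) :
  threshold_rel a c -> star_set a c = set0.
Proof.
move=> h; rewrite (star_set_right h) //; apply/setP=> i; rewrite !inE.
by apply/negP => /andP[/(thr_left h)]; rewrite (thr_sym h) => ->.
Qed.

Lemma centre_in_star_set (k : nat) (a : rel 'I_k) (c j : 'I_k) :
  threshold_rel a c -> j != c -> c \in star_set a j.
Proof.
move=> h jc; rewrite inE; case: ltnP => cj; first exact: thr_right h _ cj.
have jc' : (j < c)%N by rewrite ltn_neqAle jc.
by rewrite jc' (thr_left h).
Qed.

(** The set [star_set a j + j] is a module: left of the centre, a vertex on the
    left of [j] sees all of it and a non-neighbour on the right of [j] sees
    none of it; right of the centre, a neighbour on the left of [j] sees all of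
    it and a vertex on the right of [j] none. *)
Lemma threshold_star_eigen (R : comNzRingType) (k : nat) (a : rel 'I_k)
    (c j : 'I_k) :
  threshold_rel a c ->
  laplacian_mx R a (ord_tuple k) *m star_vec R j (star_set a j) =
    (degree a j + (j < c))%:R *: star_vec R j (star_set a j).
Proof.
move=> h; apply: star_vec_eigen (star_set_notin a j) _ _.
- exact: thr_sym h.
- exact: thr_irr h.
- case: ltnP => jc l; rewrite ?(star_set_left h jc) ?(star_set_right h jc) inE.
    by case/andP.
  by case/andP=> _ /negbTE.
move=> i + ij l; case: (ltnP j c) => jc;
  rewrite ?(star_set_left h jc) ?(star_set_right h jc) !inE => + /andP[jl ajl].
- case: (ltnP i j) => [lij _|]; last first.
    rewrite leq_eqVlt eq_sym val_eqE (negbTE ij) /= => ji.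
    rewrite ji /= => /negbTE naji.
    rewrite [a i j](thr_sym h) naji; apply/negbTE; apply: contraFN naji => ail.
    by rewrite (threshold_dom h (ltnW jl) (ltn_neq ji)) // (thr_sym h).
  have il := ltn_trans lij jl.
  rewrite (threshold_clique h lij (ltnW jc)).
  exact: threshold_dom h (ltnW lij) (ltn_neq il) ajl.
- case: (ltnP i j) => [lij|]; last first.
    rewrite leq_eqVlt eq_sym val_eqE (negbTE ij) /= => ji _.
    rewrite [a i j](thr_sym h) (negbTE (threshold_indep h jc ji)).
    apply: contraNF ajl => ail.
    by apply: (threshold_dom h (ltnW ji)) => //; rewrite eq_sym ltn_neq.
  rewrite /= negbK => aji; rewrite (thr_sym h i j) aji (thr_sym h).
  apply: (threshold_dom h (ltnW jl)) => //.
  by apply: contraNneq ajl => ->.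
Qed.

(** * Degrees and the conjugate sequence *)

Lemma card_ord_lt (k p : nat) : (p <= k)%N -> #|[set l : 'I_k | (l < p)%N]| = p.
Proof.
move=> pk.
have -> : [set l : 'I_k | (l < p)%N] = [set widen_ord pk i | i : 'I_p].
  apply/setP=> l; rewrite inE; apply/idP/imsetP => [lp|[i _ ->]].
    by exists (Ordinal lp) => //; apply: val_inj.
  exact: (ltn_ord i).
rewrite card_imset ?card_ord // => x y /(congr1 val) /= ?; exact: val_inj.
Qed.

(** By nesting, the neighbours of [m] form an initial segment of the line with
    [m] omitted. It reaches [j] exactly when it has at least as many elements
    as there are positions up to [j] other than [m]: [j] of them if [m] is left
    of [j], and [j + 1] if it is right of [j]. *)
Lemma threshold_degree (k : nat) (a : rel 'I_k) (c m j : 'I_k) :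
  threshold_rel a c -> m != j -> a m j = (j + (j < m) <= degree a m)%N.
Proof.
move=> h mj; rewrite /degree; apply/idP/idP => [amj|].
  have := subset_leq_card
    (_ : [set l : 'I_k | (l < j.+1)%N] :\ m \subset [set l | a m l]).
  have := cardsD1 m [set l : 'I_k | (l < j.+1)%N].
  rewrite card_ord_lt // inE ltnS => e1 e2.
  apply: (leq_trans _ (e2 _)).
    by move: e1; rewrite (ltnNge j); case: (m <= j)%N => /=;
      rewrite ?add0n ?add1n ?addn0 ?addn1; [case=> {1}-> | move=> <-].
  apply/subsetP=> l; rewrite !inE ltnS => /andP[lm lj].
  rewrite (thr_sym h); apply: (threshold_dom h lj) => //.
  by rewrite (thr_sym h).
apply: contraTT => namj; rewrite -ltnNge.
have := subset_leq_card
  (_ : [set l | a m l] \subset [set l : 'I_k | (l < j)%N] :\ m).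
have := cardsD1 m [set l : 'I_k | (l < j)%N].
rewrite card_ord_lt ?(ltnW (ltn_ord j)) // inE => e1 e2.
apply: leq_ltn_trans (e2 _) _.
  apply/subsetP=> l; rewrite !inE => aml.
  apply/andP; split; first by apply: contraTneq aml => ->; rewrite (thr_irr h).
  rewrite ltnNge; apply: contra namj => jl; rewrite (thr_sym h).
  by apply: (threshold_dom h jl); rewrite 1?eq_sym // (thr_sym h).
move: e1; rewrite (ltnNge j) (ltn_neqAle m) val_eqE mj /=.
by case: (m <= j)%N => /=; rewrite ?add0n ?add1n ?addn0 ?addn1 => <-.
Qed.

Definition conj_deg (k : nat) (a : rel 'I_k) (p : nat) : nat :=
  #|[set m : 'I_k | (p <= degree a m)%N]|.

(** The vertices of degree above [j] are [j] and its neighbours: joined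
    vertices are adjacent to all the positions up to [c], hence have degree at
    least [c]. *)
Lemma conj_deg_left (k : nat) (a : rel 'I_k) (c j : 'I_k) :
  threshold_rel a c -> (j < c)%N -> conj_deg a j.+1 = (degree a j).+1.
Proof.
move=> h jc.
have big_deg (m : 'I_k) : (m < c)%N -> (c <= degree a m)%N.
  move=> mc; have := threshold_degree h (ltn_neq mc).
  by rewrite (thr_left h mc) ltnNge (ltnW mc) /= addn0 => <-.
rewrite /conj_deg (_ : [set m | _] = j |: [set m | a j m]).
  by rewrite cardsU1 inE (thr_irr h).
apply/setP=> m; rewrite !inE; have [->|mj] /= := eqVneq m j.
  exact: leq_trans jc (big_deg _ jc).
rewrite (thr_sym h); case: (ltnP m j) => [lmj|].
  rewrite (threshold_clique h lmj (ltnW jc)).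
  by rewrite (leq_trans jc) // big_deg // (ltn_trans lmj).
rewrite leq_eqVlt eq_sym val_eqE (negbTE mj) /= => jm.
by rewrite (threshold_degree h mj) jm addn1.
Qed.

(** The vertices of degree at least [j] are the neighbours of [j]: a vertex
    right of the centre sees only positions left of [c], hence has degree at
    most [c]. *)
Lemma conj_deg_right (k : nat) (a : rel 'I_k) (c j : 'I_k) :
  threshold_rel a c -> (c < j)%N -> conj_deg a j = degree a j.
Proof.
move=> h cj.
have small_deg (m : 'I_k) : (c < m)%N -> (degree a m <= c)%N.
  move=> cm; have mc : m != c by rewrite eq_sym ltn_neq.
  have := threshold_degree h mc.
  rewrite (negbTE (thr_right h cm)) cm addn1 => /esym/negbT.
  by rewrite -ltnNge ltnS.
rewrite /conj_deg {2}/degree; apply: eq_card => m; rewrite !inE.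
have [->|mj] := eqVneq m j.
  by rewrite (thr_irr h) leqNgt (leq_ltn_trans (small_deg _ cj)).
rewrite (thr_sym h); case: (ltnP m j) => [lmj|].
  by rewrite (threshold_degree h mj) (ltnNge j) (ltnW lmj) /= addn0.
rewrite leq_eqVlt eq_sym val_eqE (negbTE mj) /= => jm.
have cm := ltn_trans cj jm.
rewrite leqNgt (leq_ltn_trans (small_deg _ cm)) //.
by rewrite (thr_sym h) (negbTE (threshold_indep h (ltnW cj) jm)).
Qed.

Lemma conj_deg_last (k : nat) (a : rel 'I_k) :
  irreflexive a -> conj_deg a k = 0%N.
Proof.
move=> irra; apply/eqP; rewrite cards_eq0; apply/eqP/setP=> m; rewrite !inE.
rewrite leqNgt; apply/negbF; rewrite /degree -[X in (_ < X)%N]card_ord.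
apply: proper_card; apply/properP; split; first exact: subset_predT.
by exists m; rewrite // inE irra.
Qed.

Lemma conj_deg_mono (k : nat) (a : rel 'I_k) (p q : nat) :
  (p <= q)%N -> (conj_deg a q <= conj_deg a p)%N.
Proof.
move=> pq; apply: subset_leq_card; apply/subsetP=> m; rewrite !inE.
exact: leq_trans.
Qed.

Lemma conj_degE (k : nat) (a : rel 'I_k) (j : 'I_k) :
  tnth (conjugate_seq (degree_seq a (ord_tuple k))) j = conj_deg a j.+1.
Proof.
rewrite tnth_mktuple; apply: eq_card => m; rewrite !inE.
by rewrite tnth_mktuple tnth_ord_tuple.
Qed.

(** * The star vectors together with the all-ones vector form a basis *)

(** Maximum principle: at a maximiser [j <> c] the terms of the sum over [S j]
    are nonnegative, so all vanish, and [c] is itself a maximiser. *)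
Lemma star_average_le (R : realFieldType) (k : nat) (c : 'I_k)
    (S : 'I_k -> {set 'I_k}) (y : 'I_k -> R) :
  (forall j, j != c -> c \in S j) ->
  (forall j, j != c -> \sum_(i in S j) (y j - y i) = 0) ->
  forall i, y i <= y c.
Proof.
move=> cS avg i.
have [j _ jmax] : exists2 j, true & forall i, y i <= y j.
  have [j _ jmax] := arg_maxP y (isT : xpredT c).
  by exists j => // l; apply: jmax.
have [<-//|jc] := eqVneq j c.
have gap_ge0 l : l \in S j -> 0 <= y j - y l by rewrite subr_ge0.
have /eqP := psumr_eq0P gap_ge0 (avg j jc) (cS j jc).
by rewrite subr_eq0 => /eqP<-.
Qed.

(** The maximum principle applied to [y] and to [- y]. *)
Lemma star_average_const (R : realFieldType) (k : nat) (c : 'I_k)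
    (S : 'I_k -> {set 'I_k}) (y : 'I_k -> R) :
  (forall j, j != c -> c \in S j) ->
  (forall j, j != c -> \sum_(i in S j) (y j - y i) = 0) ->
  forall i, y i = y c.
Proof.
move=> cS avg i; apply/eqP; rewrite eq_le (star_average_le cS avg) /=.
rewrite -lerN2; apply: (star_average_le (y := fun i => - y i) cS) => j jc.
rewrite (eq_bigr (fun i => - (y j - y i))) => [|l _]; last by rewrite opprD.
by rewrite sumrN avg // oppr0.
Qed.

Definition star_basis (R : nzRingType) (n : nat) (c : 'I_n.+1)
    (S : 'I_n.+1 -> {set 'I_n.+1}) : 'M[R]_n.+1 :=
  castmx (erefl n.+1, addn1 n)
    (row_mx (col' c (\matrix_(i, j) star_vec R j (S j) i 0))
            (const_mx 1 : 'cV[R]_n.+1)).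

Lemma col_star_basis (R : nzRingType) (n : nat) (c : 'I_n.+1)
    (S : 'I_n.+1 -> {set 'I_n.+1}) (j : 'I_n) :
  col (widen_ord (leqnSn n) j) (star_basis R c S) =
    star_vec R (lift c j) (S (lift c j)).
Proof.
apply/matrixP=> i o; rewrite (ord1 o) {o} mxE castmxE /=.
have -> : cast_ord (esym (addn1 n)) (widen_ord (leqnSn n) j) = lshift 1 j.
  exact: val_inj.
by rewrite row_mxEl cast_ord_id !mxE.
Qed.

Lemma col_star_basis_last (R : nzRingType) (n : nat) (c : 'I_n.+1)
    (S : 'I_n.+1 -> {set 'I_n.+1}) :
  col ord_max (star_basis R c S) = const_mx 1.
Proof.
apply/matrixP=> i o; rewrite (ord1 o) {o} mxE castmxE /=.
have -> : cast_ord (esym (addn1 n)) ord_max = rshift n ord0.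
  by apply: val_inj; rewrite /= addn0.
by rewrite row_mxEr !mxE.
Qed.

Lemma star_basis_unit (R : realFieldType) (n : nat) (c : 'I_n.+1)
    (S : 'I_n.+1 -> {set 'I_n.+1}) :
  (forall j, j != c -> c \in S j) -> star_basis R c S \in unitmx.
Proof.
move=> cS; rewrite -row_free_unit; apply: inj_row_free => y yV0.
have dot0 j : \sum_i y 0 i * col j (star_basis R c S) i 0 = 0.
  transitivity ((y *m star_basis R c S) 0 j); last by rewrite yV0 mxE.
  by rewrite [RHS]mxE; apply: eq_bigr => i _; rewrite mxE.
have yc : forall i, y 0 i = y 0 c.
  apply: (star_average_const (y := y 0) cS) => j jc.
  have [j' -> _] : {j' | j = lift c j' & unlift c j = Some j'}.
    by apply: unlift_some; rewrite eq_sym.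
  by rewrite -dot_star_vec -col_star_basis dot0.
have := dot0 ord_max; rewrite col_star_basis_last.
under eq_bigr => i _ do rewrite mxE mulr1 yc.
move=> /eqP; rewrite sumr_const card_ord mulrn_eq0 /= => /eqP yc0.
by apply/rowP=> i; rewrite yc yc0 mxE.
Qed.

(** Over the polynomial ring, [('X - A) V = V ('X - D)]; the determinant of [V]
    cancels. *)
Lemma char_poly_diagonalized (R : fieldType) (k : nat)
    (A V : 'M[R]_k) (d : 'rV[R]_k) :
  V \in unitmx -> A *m V = V *m diag_mx d ->
  char_poly A = \prod_(i < k) ('X - (d 0 i)%:P).
Proof.
move=> Vu AV.
have -> : char_poly A = char_poly (diag_mx d).
  have Vp : map_mx polyC V \in unitmx.
    by rewrite unitmxE det_map_mx rmorph_unit // -unitmxE.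
  apply: (mulrI (_ : \det (map_mx polyC V) \is a GRing.unit)) => //.
  rewrite [LHS]mulrC /char_poly -!det_mulmx /char_poly_mx.
  rewrite mulmxBl mulmxBr -!map_mxM AV /= scalar_mxC //.
rewrite char_poly_trig ?diag_mx_is_trig //.
by apply: eq_bigr => i _; rewrite mxE eqxx.
Qed.

Lemma nth_largest_eigenvalueP (R : realFieldType) (k : nat) (A V : 'M[R]_k)
    (d : 'I_k -> R) (j : 'I_k) :
  V \in unitmx -> (forall i, A *m col i V = d i *: col i V) ->
  {homo d : i j / (i <= j)%N >-> i >= j} ->
  nth_largest_eigenvalue A j (d j).
Proof.
move=> Vu eigV dmono; exists [tuple d i | i < k]; split.
- rewrite sorted_pairwise; last by move=> x y z /[swap]; apply: le_trans.
  apply/(pairwiseP 0) => i l; rewrite !inE size_tuple => ik lk il.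
  rewrite -[i]/(nat_of_ord (Ordinal ik)) -[l]/(nat_of_ord (Ordinal lk)).
  by rewrite -!tnth_nth !tnth_mktuple; apply: dmono; apply: ltnW.
- rewrite big_tuple (char_poly_diagonalized (d := \row_i d i) Vu).
    by apply: eq_bigr => i _; rewrite mxE tnth_mktuple.
  apply/matrixP=> i l; rewrite mul_mx_diag !mxE.
  have /matrixP/(_ i 0) := eigV l; rewrite !mxE mulrC => <-.
  by apply: eq_bigr => m _; rewrite mxE.
- by rewrite tnth_mktuple.
Qed.

(** * The output of the column loop *)

(** The body of the loop reads and writes only its own column, so that each
    column can be computed from the initial matrix. *)
Lemma column_stepE (R : nzRingType) (k : nat) (j i l : 'I_k) (V : 'M[R]_k) :
  reset_diag j (flip_above j V) i l =
    if l == j then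
      if i == j then
        - \sum_(m < k | m != j) (if (m < j)%N then -1 - V m j else V m j)
      else if (i < j)%N then -1 - V i j else V i j
    else V i l.
Proof.
rewrite !mxE; have [->|//] := eqVneq l j => /=.
have [_|//] := eqVneq i j.
by congr (- _); apply: eq_bigr => m _; rewrite mxE eqxx.
Qed.

Lemma column_stepsE (R : nzRingType) (k : nat) (r : seq 'I_k) (V : 'M[R]_k)
    (i l : 'I_k) :
  uniq r ->
  foldl (fun V j => reset_diag j (flip_above j V)) V r i l =
    if l \in r then reset_diag l (flip_above l V) i l else V i l.
Proof.
elim: r V => [|j r IHr] V //= /andP[jr Ur]; rewrite IHr // inE.
have [->|lj] /= := eqVneq l j; first by rewrite (negbTE jr).
case: ifP => // _; rewrite !column_stepE ?(negbTE lj) ?eqxx //=.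
case: eqP => // _; congr (- _); apply: eq_bigr => m _.
by rewrite !column_stepE (negbTE lj).
Qed.

(** Column [0] is not visited by the loop, but it already has the common form:
    no vertex lies to its left, and its diagonal entry is minus the sum of the
    other ones. *)
Lemma column_loop_laplacian (R : nzRingType) (n : nat) (a : rel 'I_n.+1) :
  symmetric a -> irreflexive a ->
  column_loop (laplacian_mx R a (ord_tuple n.+1)) =
    \matrix_(i, j) star_vec R j (star_set a j) i 0.
Proof.
move=> syma irra; apply/matrixP=> i l.
rewrite /column_loop column_stepsE; last exact/filter_uniq/enum_uniq.
rewrite mem_filter mem_enum andbT [RHS]mxE [RHS]mxE.
set L := laplacian_mx _ _ _.
have Lout m : m != l -> (if (m < l)%N then -1 - L m l else L m l) =
    - (m \in star_set a l)%:R.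
  move=> ml; rewrite laplacianE (negbTE ml) mul0r sub0r inE (syma m).
  case: ifP => lml.
    by case: (a l m); rewrite ?opprK ?subrr ?oppr0 ?addr0 ?addNr.
  by rewrite ltnNge leq_eqVlt val_eqE (negbTE ml) /= lml.
have -> : (if l != ord0 then reset_diag l (flip_above l L) i l else L i l)
    = if i == l then - \sum_(m < n.+1 | m != l)
        (if (m < l)%N then -1 - L m l else L m l)
      else if (i < l)%N then -1 - L i l else L i l.
  have [->|_] /= := eqVneq l ord0; last by rewrite column_stepE eqxx.
  have [->|//] := eqVneq i ord0.
  rewrite laplacianE eqxx irra mul1r subr0 degreeE (bigD1 ord0) //= irra add0r.
  rewrite -sumrN; apply: eq_bigr => m m0.
  by rewrite laplacianE (negbTE m0) mul0r sub0r opprK syma.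
have [->|il] := eqVneq i l; last by rewrite Lout // mul0r sub0r.
rewrite (negbTE (star_set_notin a l)) subr0 mul1r -sum1_card natr_sum.
rewrite (eq_bigr _ Lout) sumrN opprK big_mkcond [RHS]big_mkcond /=.
apply: eq_bigr => m _; have [->|_] := eqVneq m l.
  by rewrite (negbTE (star_set_notin a l)).
by case: ifP.
Qed.

(** The column of the centre is zero, and every other column has the entry [-1]
    in the row of the centre. *)
Lemma algorithm1_laplacian (R : realFieldType) (n : nat) (a : rel 'I_n.+1)
    (c : 'I_n.+1) :
  threshold_rel a c ->
  algorithm1 (laplacian_mx R a (ord_tuple n.+1)) =
    Some (star_basis R c (star_set a)).
Proof.
move=> h; rewrite /algorithm1.
rewrite (column_loop_laplacian R (thr_sym h) (thr_irr h)).
set W := \matrix_(i, j) _.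
suff -> : [set j | col j W == 0] = [set c] by rewrite set1K.
apply/setP=> j; rewrite !inE; have [->|jc] := eqVneq j c.
  apply/eqP/matrixP=> i o; rewrite !mxE (star_set_centre h).
  by rewrite cards0 inE mulr0 subr0.
apply/eqP => /matrixP/(_ c 0); rewrite !mxE eq_sym (negbTE jc) mul0r.
by rewrite (centre_in_star_set h jc) sub0r => /eqP; rewrite oppr_eq0 oner_eq0.
Qed.

(** * Placing the vertices of a threshold graph on a line *)

Lemma threshold_line_uniq (T : finType) (e : rel T) (s : seq T) :
  threshold_line e s -> uniq s.
Proof.
by elim=> // x t _ Ut xt _; rewrite /= ?rcons_uniq xt Ut.
Qed.

(** The starting vertex [c]: a join puts the new vertex on its left, adjacent
    to it, and a union on its right, not adjacent to it. *)
Lemma threshold_line_centre (T : finType) (e : rel T) (s : seq T) (x0 : T) :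
  symmetric e -> threshold_line e s ->
  exists2 c, (c < size s)%N & forall i, (i < size s)%N ->
    ((i < c)%N -> e (nth x0 s i) (nth x0 s c)) /\
    ((c < i)%N -> ~~ e (nth x0 s i) (nth x0 s c)).
Proof.
move=> syme; elim=> [x|x t _ [c ct IH] xt xj|x t _ [c ct IH] xt xu].
- by exists 0%N => // -[|[]].
- exists c.+1 => // -[|i] it /=; last exact: IH.
  by split=> // _; apply/xj/mem_nth.
- exists c => [|i]; rewrite size_rcons ltnS; first exact: ltnW.
  rewrite !nth_rcons ct leq_eqVlt => /orP[/eqP->|it]; last first.
    by rewrite it; apply: IH.
  rewrite ltnn eqxx; split=> [|_]; first by rewrite ltnNge ltnW.
  exact/xu/mem_nth.
Qed.

(** A joined vertex, placed leftmost, is adjacent to everything present, and an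
    added isolated vertex, placed rightmost, to nothing: neither breaks the
    nesting of the neighbourhoods. *)
Lemma threshold_line_dom (T : finType) (e : rel T) (s : seq T) (x0 : T)
    (i j l : nat) :
  symmetric e -> threshold_line e s ->
  (i < j < size s)%N -> (l < size s)%N -> l != i -> l != j ->
  e (nth x0 s j) (nth x0 s l) -> e (nth x0 s i) (nth x0 s l).
Proof.
move=> syme tl; elim: tl i j l => [x|x t _ IH xt xj|x t _ IH xt xu] i j l.
- by case: j => [|j]; rewrite ?ltn0 ?andbF.
- case: j => [|j]; rewrite ?ltn0 //=; case: l => [|l]; case: i => [|i] //=.
    move=> /andP[ij jt] _ _ _ _; rewrite syme; apply/xj/mem_nth.
    by rewrite ltnS in ij; exact: ltn_trans ij jt.
    by move=> _ lt _ _ _; apply/xj/mem_nth.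
  rewrite !ltnS !eqSS; exact: IH.
- rewrite size_rcons !ltnS => /andP[ij jt] lt li lj.
  have it := leq_trans ij jt.
  rewrite !nth_rcons it; move: jt lt.
  rewrite leq_eqVlt => /orP[/eqP jt|jt]; rewrite leq_eqVlt => /orP[/eqP lt|lt].
  + by rewrite jt lt eqxx in lj.
  + rewrite jt ltnn eqxx lt => exl.
    by case/negP: (xu _ (mem_nth x0 lt)).
  + rewrite jt lt ltnn eqxx syme => exj.
    by case/negP: (xu _ (mem_nth x0 jt)).
  + by rewrite jt lt; apply: IH => //; rewrite ij.
Qed.

(** The graph transported to positions, so that the list of vertices becomes
    the identity tuple. *)
Definition line_rel (T : finType) (e : rel T) (k : nat) (s : k.-tuple T) :
    rel 'I_k := [rel i j | e (tnth s i) (tnth s j)].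

Lemma line_rel_threshold (T : finType) (e : rel T) (n : nat)
    (s : n.+1.-tuple T) :
  simple_graph e -> threshold_line e s ->
  exists c, threshold_rel (line_rel e s) c.
Proof.
move=> [syme irre] tl.
pose x0 := tnth s ord0.
have [c ct cP] := threshold_line_centre x0 syme tl.
rewrite size_tuple in ct; exists (Ordinal ct); split.
- by move=> i j; apply: syme.
- by move=> i; apply: irre.
- move=> i j l ij li lj; rewrite /line_rel /= !(tnth_nth x0).
  by apply: threshold_line_dom; rewrite ?size_tuple ?ij ?ltn_ord ?val_eqE.
- move=> i ic; rewrite /line_rel /= !(tnth_nth x0) /=.
  by case: (cP i) => [|+ _]; [rewrite size_tuple | apply].
- move=> i ic; rewrite /line_rel /= !(tnth_nth x0) /=.
  by case: (cP i) => [|_]; [rewrite size_tuple | apply].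
Qed.

Lemma degree_line_rel (T : finType) (e : rel T) (k : nat) (s : k.-tuple T)
    (i : 'I_k) :
  uniq s -> (forall x, x \in s) ->
  degree (line_rel e s) i = degree e (tnth s i).
Proof.
move=> /tuple_uniqP sinj sfull; rewrite /degree -(card_imset _ sinj).
apply: eq_card => x; rewrite inE; apply/imsetP/idP => [[j]|ex].
  by rewrite inE => eij ->.
by have /tnthP[j xj] := sfull x; exists j; rewrite ?inE /line_rel /= -?xj.
Qed.

Lemma degree_seq_line_rel (T : finType) (e : rel T) (k : nat) (s : k.-tuple T) :
  uniq s -> (forall x, x \in s) ->
  degree_seq e s = degree_seq (line_rel e s) (ord_tuple k).
Proof.
move=> su sf; apply: eq_from_tnth => i.
by rewrite !tnth_mktuple tnth_ord_tuple degree_line_rel.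
Qed.

Lemma laplacian_line_rel (R : nzRingType) (T : finType) (e : rel T) (k : nat)
    (s : k.-tuple T) :
  uniq s -> (forall x, x \in s) ->
  laplacian_mx R e s = laplacian_mx R (line_rel e s) (ord_tuple k).
Proof.
move=> su sf; rewrite /laplacian_mx /degree_mx degree_seq_line_rel //.
by congr (_ - _); apply/matrixP=> i j; rewrite !mxE !tnth_ord_tuple.
Qed.

(** * Eigenvectors and spectrum of the Laplacian *)

(** Deleting column [c] shifts the columns beyond it by one, which turns the
    eigenvalue [deg j + 1] of the left part and [deg j] of the right part into
    the same entry of the conjugate sequence. *)
Lemma star_basis_eigen (R : realFieldType) (n : nat) (a : rel 'I_n.+1)
    (c j : 'I_n.+1) :
  threshold_rel a c ->
  laplacian_mx R a (ord_tuple n.+1) *m col j (star_basis R c (star_set a)) =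
    (conj_deg a j.+1)%:R *: col j (star_basis R c (star_set a)).
Proof.
move=> h; have [->|jn] := eqVneq j ord_max.
  rewrite col_star_basis_last conj_deg_last; last exact: thr_irr h.
  apply/matrixP=> i o; rewrite (ord1 o) scale0r laplacian_mulE !mxE mulr1.
  rewrite degreeE.
  under [X in _ - X]eq_bigr => l _ do rewrite mxE mulr1.
  exact: subrr.
have jn' : (j < n)%N by rewrite ltn_neqAle jn -ltnS ltn_ord.
have -> : j = widen_ord (leqnSn n) (Ordinal jn') by apply: val_inj.
rewrite col_star_basis (threshold_star_eigen R (lift c _) h) /=.
congr (_%:R *: _); set j' := lift c _.
rewrite -[bump c j]/(nat_of_ord j'); case: (leqP c j) => cj.
  have ej : j' = j.+1 :> nat by rewrite /= /bump cj.
  have cj' : (c < j')%N by rewrite ej ltnS.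
  by rewrite ltnNge (ltnW cj') addn0 -ej (conj_deg_right h cj').
have ej : j' = j :> nat by rewrite /= /bump leqNgt cj.
have j'c : (j' < c)%N by rewrite ej.
by rewrite j'c addn1 -ej (conj_deg_left h j'c).
Qed.

Theorem mainTheorem1 (R : realFieldType) (T : finType) (e : rel T) (n : nat)
    (s : n.+1.-tuple T) :
  simple_graph e -> connected_graph e -> threshold_order e s ->
  let L := laplacian_mx R e s in
  let dstar := conjugate_seq (degree_seq e s) in
  exists V : 'M[R]_n.+1,
    algorithm1 L = Some V /\
    forall j : 'I_n.+1,
      eigenvector L (tnth dstar j)%:R (col j V) /\
      nth_largest_eigenvalue L j (tnth dstar j)%:R.
Proof.
move=> simple_e _ [line_s full_s]; have uniq_s := threshold_line_uniq line_s.
have [c h] := line_rel_threshold simple_e line_s.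
move=> L dstar; rewrite /L /dstar laplacian_line_rel // degree_seq_line_rel //.
set a := line_rel e s in h *.
have Vu := star_basis_unit R (fun j => @centre_in_star_set _ a c j h).
exists (star_basis R c (star_set a)).
split; first exact: algorithm1_laplacian.
move=> j; rewrite conj_degE; split; last first.
  apply: (nth_largest_eigenvalueP (d := fun i => (conj_deg a i.+1)%:R) j Vu).
    by move=> i; apply: star_basis_eigen.
  by move=> i l il; rewrite ler_nat conj_deg_mono.
split; last exact: star_basis_eigen.
apply: contraTneq Vu => V0; rewrite unitmxE unitfE negbK.
rewrite -det_tr; apply/det0P; exists (delta_mx 0 j).
  by apply/eqP => /matrixP/(_ 0 j)/eqP; rewrite !mxE !eqxx oner_eq0.
by rewrite -rowE -tr_col V0 trmx0.
Qed.
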